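(* Let $g$ be a power series with $g(0)\equiv1\pmod 2$. The Riordan graph $G=G_n(g,tg)$ is io-decomposable if and only if its binary $A$-sequence is of the form $(1,1,a_2,a_2,a_4,a_4,\ldots)$, $a_{2j}\in\{0,1\}$, whose generating function is $$A(t)\equiv(1+t)+(1+t)\sum_{j\ge1}a_{2j}t^{2j}.$$
   Context: Power series are in the variable $t$ with coefficients in $\mathbb{Z}$ (or $\mathbb{Z}_2$); $\equiv$ means congruence mod $2$ (coefficientwise for power series); $[t^k]u$ is the coefficient of $t^k$ in $u$. For power series $g,f$ with $f(0)=0$, the Riordan graph $G_n(g,f)$ is the simple graph on the vertex set $\{1,\dots,n\}$ in which, for $i>j\ge1$, the vertices $i$ and $j$ are adjacent if and only if $[t^{i-2}]\,g f^{\,j-1}\equiv 1$. It is proper if the matrix of the coefficients $[t^i]gf^j$ mod $2$, $0\le i,j\le n-2$, is a proper (i.e. invertible) binary Riordan matrix, which means $g(0)\equiv f'(0)\equiv1$. The binary $A$-sequence of a proper Riordan graph $G_n(g,f)$ is the unique $(0,1)$-sequence whose generating function $A(t)$ satisfies $f\equiv tA(f)$; for $f=tg$ this reads $g\equiv A(tg)$. A proper Riordan graph $G_n(g,f)$, with odd vertex set $V_o$ and even vertex set $V_e$, is io-decomposable if the induced subgraph $\langle V_o\rangle$ is isomorphic (as a graph) to $G_{\lceil n/2\rceil}(g,f)$ and the induced subgraph $\langle V_e\rangle$ is a null graph (no edges).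
   Formalization: The equivalence is stated for ''G_n(g,tg) is io-decomposable for all n ≥ 1'' rather than for one fixed n, since for a single n (e.g. n=1, or g=1+t with n=7) G_n can be io-decomposable although the A-sequence is not of the stated form. *)

(* Defs.v *)
From HB Require Import structures.
From mathcomp Require Import all_boot all_order all_algebra.

Set Implicit Arguments.
Unset Strict Implicit.
Unset Printing Implicit Defensive.

Import Order.TTheory GRing.Theory Num.Theory.
Local Open Scope ring_scope.

(** * Formal power series over the integers *)

(* [u k] is the coefficient of t^k in u. *)
Definition series := nat -> int.

Definition sX : series := fun k => (k == 1%N)%:R.
Definition sone : series := fun k => (k == 0%N)%:R.
Definition sadd (u v : series) : series := fun k => u k + v k.
Definition smul (u v : series) : series :=
  fun k => \sum_(i < k.+1) u i * v (k - i)%N.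
Definition spow (u : series) (n : nat) : series := iter n (smul u) sone.

(* The composite A(f). It is only meaningful when f(0) = 0: then t^i divides
   f^i, so the terms a_i f^i with i > k do not contribute to the coefficient
   of t^k (see [spow_lt]). *)
Definition scomp (A f : series) : series :=
  fun k => \sum_(i < k.+1) A i * spow f i k.

Definition scong2 (u v : series) : Prop :=
  forall k, (u k = v k %[mod 2])%Z.

(** * Simple graphs *)

Record sgraph := SGraph {
  vertex :> finType;
  adj : rel vertex;
  adj_sym : symmetric adj;
  adj_irr : irreflexive adj }.

Definition graph_iso (G H : sgraph) : Prop :=
  exists2 h : G -> H, bijective h & forall x y, adj (h x) (h y) = adj x y.

Definition null_graph (G : sgraph) : Prop := forall x y : G, ~~ adj x y.

Section Induced.
Variables (G : sgraph) (V : {set G}).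
Definition induced_adj : rel {x : G | x \in V} :=
  fun x y => adj (val x) (val y).
Lemma induced_sym : symmetric induced_adj.
Proof. by move=> x y; rewrite /induced_adj adj_sym. Qed.
Lemma induced_irr : irreflexive induced_adj.
Proof. by move=> x; rewrite /induced_adj adj_irr. Qed.
Definition induced : sgraph := SGraph induced_sym induced_irr.
End Induced.

(** * Riordan graphs *)

Definition riordan_edge (g f : series) (i j : nat) : bool :=
  (1 <= j < i)%N && (smul g (spow f (j - 1)) (i - 2)%N == 1 %[mod 2])%Z.

(* The vertex v : 'I_n carries the label v.+1, an element of {1, ..., n}. *)
Definition label (n : nat) (v : 'I_n) : nat := v.+1.

Section RiordanGraph.
Variables (n : nat) (g f : series).
Definition riordan_adj : rel 'I_n := fun u v =>
  riordan_edge g f (label u) (label v) || riordan_edge g f (label v) (label u).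
Lemma riordan_sym : symmetric riordan_adj.
Proof. by move=> u v; rewrite /riordan_adj orbC. Qed.
Lemma riordan_irr : irreflexive riordan_adj.
Proof. by move=> u; rewrite /riordan_adj /riordan_edge ltnn andbF. Qed.
Definition riordan_graph : sgraph := SGraph riordan_sym riordan_irr.
Definition odd_vertices : {set riordan_graph} :=
  [set v : 'I_n | odd (label v)].
Definition even_vertices : {set riordan_graph} :=
  [set v : 'I_n | ~~ odd (label v)].
End RiordanGraph.

Definition proper_riordan (g f : series) : Prop :=
  (g 0%N = 1 %[mod 2])%Z /\ (f 1%N = 1 %[mod 2])%Z.

Definition io_decomposable (n : nat) (g f : series) : Prop :=
  [/\ proper_riordan g f,
      graph_iso (induced (odd_vertices n g f)) (riordan_graph (uphalf n) g f)
    & null_graph (induced (even_vertices n g f))].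

(** * Binary A-sequences *)

Definition genfun (a : nat -> bool) : series := fun k => (a k)%:R.

(* Existence and uniqueness: [binary_A_seq_exists], [binary_A_seq_unique]. *)
Definition binary_A_seq (f : series) (a : nat -> bool) : Prop :=
  scong2 f (smul sX (scomp (genfun a) f)).

(* (1, 1, a_2, a_2, a_4, a_4, ...) *)
Definition paired_seq (a : nat -> bool) : Prop :=
  [/\ a 0%N = true, a 1%N = true
    & forall j, (1 <= j)%N -> a (2 * j).+1%N = a (2 * j)%N].

(* The sum over j >= 1 of a_{2j} t^{2j}. *)
Definition even_part_ge2 (a : nat -> bool) : series :=
  fun k => if ~~ odd k && (2 <= k)%N then (a k)%:R else 0.

Lemma spow_lt (f : series) (i k : nat) : f 0%N = 0 -> (k < i)%N ->
  spow f i k = 0.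
Proof.
move=> f0; elim: i k => [//|i IH] k lt_ki.
rewrite /spow iterS -/(spow f i) /smul big1 // => -[[|j] /= lt_j] _.
  by rewrite f0 mul0r.
by rewrite IH ?mulr0 //; case: k lt_ki lt_j => // k lt_ki lt_j; rewrite subSS;
  apply: leq_ltn_trans (leq_subr _ _) _.
Qed.

Lemma spow_diag (f : series) (k : nat) : f 0%N = 0 -> spow f k k = f 1%N ^+ k.
Proof.
move=> f0; elim: k => [|k IH]; first by rewrite expr0.
rewrite /spow iterS -/(spow f k) /smul 2!big_ord_recl /= f0 mul0r add0r.
rewrite subSS subn0 IH -exprS big1 ?addr0 // => i _.
rewrite spow_lt ?mulr0 //= /bump /= !add1n subSS.
by case: k i {IH} => [[]|k i] //; rewrite subSS ltnS leq_subr.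
Qed.

Lemma smul_sX0 (u : series) : smul sX u 0%N = 0.
Proof. by rewrite /smul big_ord1 mul0r. Qed.

Lemma smul_sXS (u : series) (k : nat) : smul sX u k.+1 = u k.
Proof.
rewrite /smul 2!big_ord_recl /= mul0r add0r mul1r subSS subn0.
by rewrite big1 ?addr0 // => i _; rewrite mul0r.
Qed.

Lemma scomp_top (f A : series) (k : nat) :
  f 0%N = 0 -> (f 1%N = 1 %[mod 2])%Z ->
  (scomp A f k = \sum_(i < k) A i * spow f i k + A k %[mod 2])%Z.
Proof.
move=> f0 f1; rewrite /scomp big_ord_recr /= spow_diag //.
rewrite -modzDmr -[RHS]modzDmr; congr ((_ + _) %% _)%Z.
by rewrite -modzMmr -modzXm f1 modzXm expr1n modzMmr mulr1.
Qed.

Lemma binary_A_seq_exists (f : series) :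
  f 0%N = 0 -> (f 1%N = 1 %[mod 2])%Z -> exists a, binary_A_seq f a.
Proof.
move=> f0 f1.
pose next (s : seq bool) : bool :=
  ((f (size s).+1
    - \sum_(i < size s) (nth false s i)%:R * spow f i (size s)) %% 2 == 1)%Z.
pose P n := iter n (fun s => rcons s (next s)) [::].
have sizeP n : size (P n) = n by elim: n => //= n IH; rewrite size_rcons IH.
pose a n := next (P n).
have nthP n i : (i < n)%N -> nth false (P n) i = a i.
  elim: n => // n IH; rewrite ltnS leq_eqVlt /= nth_rcons sizeP.
  by case: ltngtP => //= [lt_in|->] _ //; apply: IH.
exists a => -[|k]; first by rewrite smul_sX0 f0.
rewrite smul_sXS scomp_top //.
set S := \sum_(i < k) _.
have -> : genfun a k = ((f k.+1 - S) %% 2)%Z.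
  rewrite /genfun /a /next sizeP.
  under eq_bigr => i _ do rewrite nthP //.
  rewrite -/S; move: (modz_ge0 (f k.+1 - S) (isT : 2%Z != 0)).
  move: (ltz_pmod (f k.+1 - S) (isT : 0 < 2%Z)).
  by case: (_ %% _)%Z => [[|[|[]]]|].
by rewrite modzDmr addrC subrK.
Qed.

Lemma binary_A_seq_unique (f : series) (a b : nat -> bool) :
  f 0%N = 0 -> (f 1%N = 1 %[mod 2])%Z ->
  binary_A_seq f a -> binary_A_seq f b -> a =1 b.
Proof.
move=> f0 f1 Ha Hb k; elim/ltn_ind: k => k IH.
have: (smul sX (scomp (genfun a) f) k.+1
       = smul sX (scomp (genfun b) f) k.+1 %[mod 2])%Z by rewrite -Ha -Hb.
rewrite !smul_sXS !scomp_top //.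
have -> : \sum_(i < k) genfun a i * spow f i k
          = \sum_(i < k) genfun b i * spow f i k.
  by apply: eq_bigr => i _; rewrite /genfun IH.
move/eqP; rewrite eqz_modDl /genfun.
by case: (a k); case: (b k).
Qed.

(* Main.v *)
Require Import Defs.
From HB Require Import structures.
From mathcomp Require Import all_boot all_order all_algebra.
From mathcomp Require Import ring.

Set Implicit Arguments.
Unset Strict Implicit.
Unset Printing Implicit Defensive.

Import Order.TTheory GRing.Theory Num.Theory.
Local Open Scope ring_scope.

(** Everything is read mod 2.  Write O(u) for the series whose k-th
    coefficient is [t^(2k+1)] u.  Both sides of the equivalence say the same
    thing about g, namely O(g) = g, that is, [t^(2k+1)] g = [t^k] g for all k.
    The tool is that squares in characteristic 2 are series in t^2, so that
    O(u v^2) = O(u) v ([odd_poly_mul_sqr]).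

    The A-sequence.  Put f = t g and split A by parity, which gives
    A(t) = E(t)^2 + t B(t)^2 with E, B the series of the a_(2j) and a_(2j+1).
    With p = E(f) and q = B(f), the equation g = A(f) reads
    g = p^2 + t g q^2.  Multiplying by g, g^2 = g p^2 + t (g q)^2, and taking
    O gives O(g) p = g q.  As p(0) = g(0) = 1, O(g) = g holds iff p = q, and
    substituting f is injective, so iff E = B ([odd_poly_fixed],
    [odd_fixed_paired]).

    The graph.  For i > j, the vertices i and j are adjacent iff
    [t^(i-j-1)] g^j = 1.  Two even vertices ask for an odd coefficient of a
    square, which vanishes: the even part is always null.  The odd vertices
    2x+1 and 2y+1 ask for [t^(2(x-y)-1)] g^(2y+1) = [t^(x-y-1)] (O(g) g^y),
    whereas the vertices x+1 and y+1 ask for [t^(x-y-1)] (g g^y).  So if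
    O(g) = g, then 2x+1 |-> x+1 is an isomorphism.  Conversely, an arbitrary
    isomorphism preserves the number of edges.  If this holds for every order,
    then by subtraction the number of edges from the last vertex to the
    earlier ones is the same in both graphs ([lower_graph_iso_row]).  When
    O(g) and g agree below degree k, the edges from the (k+2)-nd vertex
    coincide except perhaps the one to the first vertex, which is governed by
    [t^k] O(g) and [t^k] g (as it takes y = 0); hence these agree too
    ([io_decomposable_bell]).

    A power series mod t^N is represented by its truncation, a polynomial
    over 'F_2, and equality mod t^N by divisibility of the difference. *)

(** * Polynomials modulo powers of the variable *)

Lemma dvdXnP (F : fieldType) N (u : {poly F}) :
  reflect (forall k, (k < N)%N -> u`_k = 0) ('X^N %| u).
Proof.
rewrite -[_ %| _]/(_ == 0) -Pdiv.IdomainMonic.take_poly_modp.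
apply: (iffP eqP) => [u0 k lt_kN|u0].
  have := congr1 (fun w : {poly F} => w`_k) u0.
  by rewrite coef_take_poly lt_kN coef0.
by apply/polyP => k; rewrite coef_take_poly coef0; case: ifP => // /u0.
Qed.

Lemma coprimep_Xn (F : fieldType) N (u : {poly F}) :
  u`_0 != 0 -> coprimep 'X^N u.
Proof.
move=> u0; apply: coprimep_expl.
by rewrite -['X]subr0 -polyC0 coprimep_sym coprimep_XsubC /root horner_coef0.
Qed.

(** Substituting a series of order exactly 1 preserves the order.  By
    induction on u = c + u' X: the constant term is unchanged, and if it
    vanishes one factor 'X can be removed on both sides, w being a unit
    modulo the powers of 'X. *)
Lemma dvdXn_comp (F : fieldType) N (u w : {poly F}) :
  w`_0 != 0 -> ('X^N %| u \Po ('X * w)) = ('X^N %| u).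
Proof.
move=> w0; elim/poly_ind: u N => [|u c IH] [|N];
  rewrite ?comp_poly0 ?dvdp0 ?expr0 ?dvd1p //.
rewrite comp_polyD comp_polyM comp_polyX comp_polyC.
have [c0|c0] := eqVneq c 0.
  rewrite c0 addr0 mulrCA (mulrC u) exprS addr0 !dvdp_mul2l ?polyX_eq0 //.
  by rewrite Gauss_dvdpl ?IH // coprimep_Xn.
have not_dvd (v : {poly F}) : ~~ ('X^(N.+1) %| v * 'X + c%:P).
  apply/dvdXnP => /(_ 0%N isT) /eqP.
  by rewrite coefD coefC coefMX add0r (negPf c0).
by rewrite ['X * w]mulrC mulrA !(negPf (not_dvd _)).
Qed.

Lemma dvdXn_odd_poly (F : fieldType) N (u : {poly F}) :
  'X^(N.*2) %| u -> 'X^N %| odd_poly u.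
Proof.
move/dvdXnP => u0; apply/dvdXnP => k lt_kN; rewrite coef_odd_poly u0 //.
by rewrite -doubleS leq_double.
Qed.

(** * Parity of exponents and squares over the field with two elements *)

Lemma F2_sqr (c : 'F_2) : c ^+ 2 = c.
Proof. by case: c => [[|[|[]]] //] lt_c; apply: val_inj. Qed.

Lemma polyF2_2 : 2%:R = 0 :> {poly 'F_2}.
Proof. by rewrite -polyC_natr pchar_Fp_0. Qed.

Lemma sqr_polyF2 (v : {poly 'F_2}) : v ^+ 2 = v \Po 'X^2.
Proof.
elim/poly_ind: v => [|v c IH]; first by rewrite comp_poly0 expr0n.
rewrite comp_polyD comp_polyM comp_polyX comp_polyC -IH sqrrD -mulr_natr.
by rewrite polyF2_2 mulr0 addr0 exprMn -[in LHS]rmorphXn /= F2_sqr.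
Qed.

Lemma odd_poly_even_odd (R : nzRingType) (u v : {poly R}) :
  odd_poly (u \Po 'X^2 + (v \Po 'X^2) * 'X) = v.
Proof.
apply/polyP => i; rewrite coef_odd_poly coefD coefMX /= !coef_comp_poly_Xn //.
by rewrite !dvdn2 /= odd_double /= add0r -muln2 mulnK.
Qed.

(** A square has only even exponents, so multiplying by it does not mix the
    parities of the exponents. *)
Lemma odd_poly_mul_sqr (u v : {poly 'F_2}) :
  odd_poly (u * v ^+ 2) = odd_poly u * v.
Proof.
rewrite sqr_polyF2 -{1}(poly_even_odd u) mulrDl mulrAC -!comp_polyM.
exact: odd_poly_even_odd.
Qed.

Lemma odd_poly1 : odd_poly (1 : {poly 'F_2}) = 0.
Proof. by rewrite -polyC1 odd_polyC. Qed.

(** Modulo powers of X, multiply G = A(XG) by G and take odd parts, with E and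
    B the even and the odd part of A: this gives O(G) E(XG) = G B(XG), where
    G and E(XG) are units and XG can be cancelled by [dvdXn_comp].  Taking odd
    parts halves the precision, whence the exponents 2N and N. *)
Lemma odd_poly_fixed (N : nat) (A G : {poly 'F_2}) :
    G`_0 != 0 -> A`_0 != 0 -> 'X^(N.*2) %| G - (A \Po ('X * G)) ->
  ('X^N %| odd_poly G - G) = ('X^N %| odd_poly A - even_poly A).
Proof.
move=> G0 A0 dvdR.
pose p := even_poly A \Po ('X * G); pose q := odd_poly A \Po ('X * G).
have AF : A \Po ('X * G) = p ^+ 2 + q ^+ 2 * ('X * G).
  rewrite -[in LHS](poly_even_odd A) -!sqr_polyF2.
  by rewrite comp_polyD (comp_polyM _ 'X) comp_polyX !rmorphXn.
have p0 : p`_0 != 0.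
  rewrite -horner_coef0 horner_comp hornerM hornerX mul0r horner_coef0.
  by rewrite coef_even_poly.
have oddX : odd_poly ('X : {poly 'F_2}) = 1.
  by rewrite -['X]mul1r odd_polyMX -polyC1 even_polyC.
(* Up to terms divisible by 2, this sum is odd_poly G * p + G * q. *)
have : 'X^N %| (odd_poly G - G) * p + G * (q - p).
  have -> : (odd_poly G - G) * p + G * (q - p)
            = - odd_poly (G * (G - (A \Po ('X * G)))).
    have -> : G * (G - (A \Po ('X * G)))
              = 1 * G ^+ 2 - G * p ^+ 2 - 'X * (G * q) ^+ 2.
      by rewrite AF; ring.
    rewrite !raddfB /= !odd_poly_mul_sqr odd_poly1 oddX.
    transitivity (odd_poly G * p + G * q - 2%:R * (G * p)); first by ring.
    by rewrite polyF2_2; ring.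
  by rewrite dvdpNr dvdXn_odd_poly // dvdp_mull.
have -> : ('X^N %| odd_poly A - even_poly A) = ('X^N %| G * (q - p)).
  by rewrite Gauss_dvdpr ?coprimep_Xn // -raddfB dvdXn_comp.
have -> : ('X^N %| odd_poly G - G) = ('X^N %| (odd_poly G - G) * p).
  by rewrite Gauss_dvdpl ?coprimep_Xn.
by move=> dvdS; apply/idP/idP => [/dvdp_addr|/dvdp_addl] <-.
Qed.

(** * Truncating integer series mod 2 *)

Lemma eqz_mod2_F2 (x y : int) :
  (x == y %[mod 2])%Z = (x%:~R == y%:~R :> 'F_2).
Proof.
rewrite eqz_mod_dvd (dvdz_pcharf (pchar_Fp (isT : prime 2))).
by rewrite rmorphB subr_eq0.
Qed.

Definition agree (N : nat) (u : series) (U : {poly 'F_2}) : Prop :=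
  forall k, (k < N)%N -> (u k)%:~R = U`_k.

Definition trunc (N : nat) (u : series) : {poly 'F_2} :=
  \poly_(k < N) (u k)%:~R.

Lemma agree_trunc N u : agree N u (trunc N u).
Proof. by move=> k lt_kN; rewrite coef_poly lt_kN. Qed.

Lemma agree_sX N : agree N sX 'X.
Proof. by move=> k _; rewrite coefX /sX; case: eqP. Qed.

Lemma agree_mul N u v U V :
  agree N u U -> agree N v V -> agree N (smul u v) (U * V).
Proof.
move=> uU vV k lt_kN; rewrite coefM rmorph_sum; apply: eq_bigr => i _.
have lt_iN : (i < N)%N by apply: leq_ltn_trans lt_kN; rewrite -ltnS.
by rewrite rmorphM /= uU // vV // (leq_ltn_trans (leq_subr _ _) lt_kN).
Qed.

Lemma agree_pow N u U n : agree N u U -> agree N (spow u n) (U ^+ n).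
Proof.
move=> uU; elim: n => [|n IH]; last by rewrite exprS; apply: agree_mul.
by move=> k _; rewrite expr0 coef1 /spow /= /sone; case: eqP.
Qed.

Lemma agree_comp N a f F : f 0%N = 0 -> agree N f F ->
  agree N (scomp a f) (trunc N a \Po F).
Proof.
move=> f0 fF k lt_kN; rewrite coef_comp_poly rmorph_sum /=.
pose c i := (trunc N a)`_i * (F ^+ i)`_k.
rewrite (eq_bigr (fun i : 'I_k.+1 => c i)); last first.
  move=> i _; rewrite rmorphM /= (agree_pow _ fF) // (@agree_trunc N) //.
  by apply: leq_trans lt_kN.
rewrite -(big_mkord xpredT c) -[RHS](big_mkord xpredT c).
(* The two sums run over i <= k and i < size; both extend by zeros. *)
have c0 i : ((size (trunc N a) <= i) || (k < i))%N -> c i = 0.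
  case/orP => [le_i|lt_ki]; first by rewrite /c nth_default ?mul0r.
  by rewrite /c -(agree_pow _ fF) // spow_lt // mulr0.
pose M := maxn k.+1 (size (trunc N a)).
transitivity (\sum_(0 <= i < M) c i).
  rewrite [RHS](big_cat_nat (n := k.+1)) ?leq_maxl //=.
  rewrite [X in _ + X]big_nat [X in _ + X]big1 ?addr0 //.
  by move=> i /andP[lt_ki _]; rewrite c0 ?lt_ki ?orbT.
rewrite (big_cat_nat (n := size (trunc N a))) ?leq_maxr //=.
rewrite [X in _ + X]big_nat [X in _ + X]big1 ?addr0 //.
by move=> i /andP[le_i _]; rewrite c0 ?le_i.
Qed.

(** * The A-sequence and the odd coefficients of g *)

Lemma odd_fixed_paired (g : series) (a : nat -> bool) :
    (g 0%N = 1 %[mod 2])%Z -> binary_A_seq (smul sX g) a ->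
  (forall k, (g k.*2.+1 = g k %[mod 2])%Z) <-> paired_seq a.
Proof.
move=> g0 ha.
have a0 : a 0%N.
  have := ha 1%N; rewrite !smul_sXS g0 /scomp big_ord1 /genfun /spow /sone /=.
  by case: (a 0%N).
have gA k : (g k = scomp (genfun a) (smul sX g) k %[mod 2])%Z.
  by have := ha k.+1; rewrite !smul_sXS.
pose G N := trunc N.*2 g; pose A N := trunc N.*2 (genfun a).
have key N : ('X^N %| odd_poly (G N) - G N)
             = ('X^N %| odd_poly (A N) - even_poly (A N)).
  case: N => [|N]; first by rewrite expr0 !dvd1p.
  apply: odd_poly_fixed.
  - by move/eqP: g0; rewrite eqz_mod2_F2 -(@agree_trunc _ g) // => /eqP ->.
  - by rewrite -(@agree_trunc _ (genfun a)) // /genfun a0.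
  have fF := agree_mul (@agree_sX N.+1.*2) (@agree_trunc _ g).
  apply/dvdXnP => k lt_k; rewrite coefB -(@agree_trunc _ g) //.
  rewrite -(@agree_comp _ _ _ _ (smul_sX0 g) fF) //.
  by apply/eqP; rewrite subr_eq0 -eqz_mod2_F2; apply/eqP.
have coefl N k : (k < N)%N ->
    (odd_poly (G N) - G N)`_k = (g k.*2.+1)%:~R - (g k)%:~R.
  move=> lt_kN; rewrite coefB coef_odd_poly -!agree_trunc //.
    by rewrite -addnn ltn_addr.
  by rewrite -doubleS leq_double.
have coefr N k : (k < N)%N ->
    (odd_poly (A N) - even_poly (A N))`_k = (a k.*2.+1)%:R - (a k.*2)%:R.
  move=> lt_kN; rewrite coefB coef_odd_poly coef_even_poly -!agree_trunc //.
  - by rewrite /genfun; do 2!case: (a _).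
  - by rewrite ltn_double.
  by rewrite -doubleS leq_double.
split=> [gfix|[_ a1 pair_a] k].
  have pair_a k : a k.*2.+1 = a k.*2.
    have: 'X^(k.+1) %| odd_poly (G k.+1) - G k.+1.
      apply/dvdXnP => i lt_ik; rewrite coefl //; apply/eqP.
      by rewrite subr_eq0 -eqz_mod2_F2; apply/eqP.
    rewrite key => /dvdXnP/(_ k (ltnSn k)); rewrite coefr //.
    by case: (a _); case: (a _).
  by split=> // [|j _]; [rewrite (pair_a 0%N) | rewrite mul2n].
apply/eqP; rewrite eqz_mod2_F2 -subr_eq0 -(coefl _ _ (ltnSn k)).
have /dvdXnP -> // : 'X^(k.+1) %| odd_poly (G k.+1) - G k.+1.
rewrite key; apply/dvdXnP => -[_|i lt_ik]; rewrite coefr //.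
  by rewrite a1 a0 subrr.
by rewrite -mul2n pair_a // subrr.
Qed.

Lemma genfun_paired a : paired_seq a ->
  scong2 (genfun a)
    (sadd (sadd sone sX) (smul (sadd sone sX) (even_part_ge2 a))).
Proof.
case=> a0 a1 pair_a [|[|k]].
- by rewrite /sadd /smul big_ord1 /genfun a0.
- by rewrite /sadd /smul !big_ord_recl big_ord0 /genfun a1.
rewrite /sadd /smul 2!big_ord_recl big1; last by move=> i _; rewrite mul0r.
rewrite /sone /sX /even_part_ge2 /genfun /= subn0 subSS subn0 /= !negbK.
case odd_k: (odd k); last by rewrite !(addr0, add0r, mul1r, mul0r).
have k_gt0 : (0 < k)%N by case: (k) odd_k.
have -> : a k.+2 = a k.+1.
  by rewrite -[k.+1]odd_double_half /= odd_k -mul2n pair_a // uphalf_gt0.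
by rewrite !ltnS k_gt0 !(addr0, add0r, mul1r).
Qed.

(** * Counting edges of growing graphs *)

Lemma graph_iso_sym G H : graph_iso G H -> graph_iso H G.
Proof.
case=> h [h' hK h'K] h_adj; exists h'; first by exists h.
by move=> x y; rewrite -h_adj !h'K.
Qed.

Lemma graph_iso_trans G H K :
  graph_iso G H -> graph_iso H K -> graph_iso G K.
Proof.
case=> h bij_h h_adj [k bij_k k_adj]; exists (k \o h); first exact: bij_comp.
by move=> x y; rewrite /= k_adj h_adj.
Qed.

(** Twice the number of edges: each edge is counted from both ends. *)
Definition adj_count (G : sgraph) : nat :=
  (\sum_(x : G) \sum_(y : G) adj x y)%N.

Lemma graph_iso_adj_count G H : graph_iso G H -> adj_count G = adj_count H.
Proof.
case=> h bij_h h_adj; rewrite /adj_count [RHS](reindex h); last exact: onW_bij.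
apply: eq_bigr => x _; rewrite [RHS](reindex h); last exact: onW_bij.
by apply: eq_bigr => y _; rewrite h_adj.
Qed.

(** The graph on {0, ..., m-1} whose adjacency matrix has the values of e
    below the diagonal.  For a fixed e these graphs extend one another as m
    grows; the Riordan graphs and their odd parts are both of this form. *)
Section LowerGraph.
Variables (m : nat) (e : rel nat).
Definition lower_adj : rel 'I_m := fun u v =>
  (v < u)%N && e u v || (u < v)%N && e v u.
Lemma lower_sym : symmetric lower_adj.
Proof. by move=> u v; rewrite /lower_adj orbC. Qed.
Lemma lower_irr : irreflexive lower_adj.
Proof. by move=> u; rewrite /lower_adj ltnn. Qed.
Definition lower_graph : sgraph := SGraph lower_sym lower_irr.
End LowerGraph.

Lemma adj_count_lowerS (e : rel nat) m :
  adj_count (lower_graph m.+1 e)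
  = (adj_count (lower_graph m e) + (\sum_(y < m) e m y).*2)%N.
Proof.
rewrite /adj_count /= big_ord_recr /= big_ord_recr /= lower_irr addn0.
rewrite (eq_bigr (fun x : 'I_m =>
  \sum_(y < m) (lower_adj e x y : nat) + e m x)%N); last first.
  move=> x _; rewrite big_ord_recr /= /lower_adj /= ltn_ord.
  by rewrite ltnNge ltnW ?ltn_ord.
rewrite big_split /= -addnA -addnn; congr (_ + (_ + _))%N.
apply: eq_bigr => y _.
by rewrite /lower_adj /= ltn_ord ltnNge ltnW ?ltn_ord // orbF.
Qed.

(** The isomorphisms are arbitrary and need not match the last vertices, but
    the edge counts of orders m and m + 1 determine the number of edges
    between the last vertex and the earlier ones. *)
Lemma lower_graph_iso_row (e e' : rel nat) :
    (forall m, graph_iso (lower_graph m e) (lower_graph m e')) ->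
  forall m, (\sum_(y < m) e m y = \sum_(y < m) e' m y)%N.
Proof.
move=> iso_ee' m; have /graph_iso_adj_count := iso_ee' m.+1.
rewrite !adj_count_lowerS (graph_iso_adj_count (iso_ee' m)).
by move/addnI/double_inj.
Qed.

Lemma riordan_graph_lower n g f :
  graph_iso (riordan_graph n g f)
    (lower_graph n (fun x y => riordan_edge g f x.+1 y.+1)).
Proof.
exists id; first by exists id.
move=> x y; rewrite /= /lower_adj /riordan_adj /riordan_edge /label.
by rewrite !ltnS !leq0n /= !andbA !andbb.
Qed.

(** A vertex with odd label 2x+1 is the ordinal 2x, and is sent to x. *)
Lemma odd_vertices_lower n g f :
  graph_iso (induced (odd_vertices n g f))
    (lower_graph (uphalf n) (fun x y => riordan_edge g f x.*2.+1 y.*2.+1)).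
Proof.
have lt_half (v : 'I_n) : (v./2 < uphalf n)%N.
  rewrite gtn_uphalf_double; apply: leq_ltn_trans (ltn_ord v).
  by rewrite -[leqRHS]odd_double_half leq_addl.
have lt_double (u : 'I_(uphalf n)) : (u.*2 < n)%N.
  by rewrite -gtn_uphalf_double.
have mem_double (u : 'I_(uphalf n)) :
    Ordinal (lt_double u) \in odd_vertices n g f.
  by rewrite inE /label /= odd_double.
pose h (v : induced (odd_vertices n g f)) := Ordinal (lt_half (val v)).
have hE (v : induced (odd_vertices n g f)) : (val v : nat) = (h v).*2.
  by have := valP v; rewrite inE /label /= => even_v; rewrite even_halfK.
exists h.
  exists (fun u => Sub (Ordinal (lt_double u)) (mem_double u)).
    by move=> v; apply/val_inj/val_inj; rewrite SubK /= -hE.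
  by move=> u; apply: val_inj; rewrite /= doubleK.
move=> x y.
rewrite /= /induced_adj /= /lower_adj /riordan_adj /riordan_edge /label.
by rewrite !hE !ltnS !leq0n !ltn_double /= !andbA !andbb.
Qed.

(** * The Riordan graphs of (g, tg) *)

(** The column of index y is g (tg)^y = t^y g^(y+1). *)
Lemma bell_edge N g x y : (x <= N)%N ->
  riordan_edge g (smul sX g) x.+1 y.+1
  = (y < x)%N && ((trunc N g ^+ y.+1)`_(x - y.+1) != 0).
Proof.
move=> le_xN; rewrite /riordan_edge /= !subSS subn0 ltnS.
case: x le_xN => //= x lt_xN; rewrite !subSS subn0 ltnS.
have [le_yx|//] := leqP y x; rewrite eqz_mod2_F2.
have gG := @agree_trunc N g.
rewrite (agree_mul gG (agree_pow y (agree_mul (@agree_sX N) gG))) //=.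
rewrite exprMn mulrCA -exprS coefXnM ltnNge le_yx /=.
by case: (_`_(x - y)) => [[|[|[]]]].
Qed.

(** The exponent y.*2.+2 makes the power a square, and the coefficient asked
    for has odd index. *)
Lemma bell_edge_even g x y : ~~ riordan_edge g (smul sX g) x.*2.+2 y.*2.+2.
Proof.
rewrite (bell_edge _ _ (leqnn _)) ltnS ltn_double; have [lt_yx|//] := ltnP y x.
rewrite /= subSS -doubleS -(mul2n y.+1) exprM.
have -> : (x.*2 - y.*2.+1 = (x - y.+1).*2.+1)%N.
  rewrite -(subnK lt_yx) addnK.
  by rewrite doubleD doubleS !addnS subSS -addSn addnK.
rewrite -coef_odd_poly exprAC -[X in odd_poly X]mul1r odd_poly_mul_sqr.
by rewrite odd_poly1 mul0r coef0 eqxx.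
Qed.

(** The power g^(2y+1) is g times the square of g^y, and the coefficient asked
    for has odd index. *)
Lemma bell_edge_odd N g x y : (x.*2 <= N)%N ->
  riordan_edge g (smul sX g) x.*2.+1 y.*2.+1
  = (y < x)%N && ((odd_poly (trunc N g) * trunc N g ^+ y)`_(x - y.+1) != 0).
Proof.
move=> le_xN; rewrite (bell_edge _ _ le_xN) ltn_double.
have [lt_yx|//] := ltnP y x; rewrite /=.
rewrite exprS -(mul2n y) exprM exprAC -odd_poly_mul_sqr coef_odd_poly.
congr (_`_ _ != 0); rewrite mul2n -(subnK lt_yx) addnK.
by rewrite doubleD doubleS !addnS subSS -addSn addnK.
Qed.

Lemma io_decomposable_bell g : (g 0%N = 1 %[mod 2])%Z ->
  (forall n, (0 < n)%N -> io_decomposable n g (smul sX g))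
  <-> (forall k, (g k.*2.+1 = g k %[mod 2])%Z).
Proof.
move=> g0.
pose e x y := riordan_edge g (smul sX g) x.+1 y.+1.
pose e_odd x y := riordan_edge g (smul sX g) x.*2.+1 y.*2.+1.
pose G x := trunc x.*2 g.
have e_row x y : e x y = (y < x)%N && ((G x * G x ^+ y)`_(x - y.+1) != 0).
  by rewrite -exprS; apply: bell_edge; rewrite -addnn leq_addr.
have odd_row x y :
    e_odd x y = (y < x)%N && ((odd_poly (G x) * G x ^+ y)`_(x - y.+1) != 0).
  exact: bell_edge_odd.
have same_edge x y :
    (forall k, (k < x - y)%N -> (g k.*2.+1 = g k %[mod 2])%Z) ->
  e_odd x y = e x y.
  move=> gfix; rewrite e_row odd_row; have [lt_yx|//] := ltnP y x; rewrite /=.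
  rewrite !coefM; congr (_ != 0); apply: eq_bigr => i _; congr (_ * _).
  have lt_i : (i < x - y)%N by rewrite -subSn // subSS in i *.
  have lt_ix : (i < x)%N by apply: leq_trans lt_i (leq_subr _ _).
  rewrite coef_odd_poly -!(@agree_trunc x.*2 g) //.
  - by apply/eqP; rewrite -eqz_mod2_F2; apply/eqP/gfix.
  - by rewrite -addnn ltn_addr.
  by rewrite -doubleS leq_double.
split=> [io_g | gfix n _]; last first.
  split; first by split; rewrite // smul_sXS.
    apply: graph_iso_trans (odd_vertices_lower _ _ _) _.
    apply: graph_iso_trans (graph_iso_sym (riordan_graph_lower _ _ _)).
    suff: graph_iso (lower_graph (uphalf n) e_odd) (lower_graph (uphalf n) e).
      by [].
    exists id; first by exists id.
    by move=> x y; rewrite /= /lower_adj !same_edge.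
  move=> [x] /=; rewrite inE /label /= negbK => odd_x [y] /=.
  rewrite inE /label /= negbK => odd_y.
  rewrite /induced_adj /= /riordan_adj /label.
  rewrite -(odd_double_half x) -(odd_double_half y) odd_x odd_y !add1n.
  by rewrite negb_or !bell_edge_even.
have iso_m m : graph_iso (lower_graph m e_odd) (lower_graph m e).
  case: m => [|m]; first by exists id; [exists id | case].
  have [_ iso_odd _] := io_g m.+1.*2 isT.
  rewrite uphalf_double in iso_odd.
  have := odd_vertices_lower m.+1.*2 g (smul sX g); rewrite uphalf_double.
  move/graph_iso_sym/graph_iso_trans => /(_ _ iso_odd) /graph_iso_trans.
  by apply; apply: riordan_graph_lower.
have row := lower_graph_iso_row iso_m.
(* In row k + 1 the column y only involves coefficients of index at most
   k - y, so the induction hypothesis covers every column but y = 0. *)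
elim/ltn_ind=> k IH; have := row k.+1.
rewrite !big_ord_recl /=.
rewrite (eq_bigr (fun y : 'I_k => e k.+1 (lift ord0 y) : nat)); last first.
  move=> y _; rewrite same_edge // => i; rewrite /= subSS => lt_i.
  by apply: IH; apply: leq_trans lt_i (leq_subr _ _).
move/addIn; rewrite e_row odd_row /= !expr0 !mulr1 subn1 /= coef_odd_poly.
have lt_k : (k < k.+1.*2)%N by rewrite -addnn ltn_addr.
rewrite -!(@agree_trunc k.+1.*2 g) //.
move=> same_parity; apply/eqP; rewrite eqz_mod2_F2.
by move: same_parity; do 2!case: (_%:~R) => [[|[|[]]] ?].
Qed.

Theorem theorem4p6 (g : series) (a : nat -> bool)
    (hg : (g 0%N = 1 %[mod 2])%Z)
    (ha : binary_A_seq (smul sX g) a) :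
  ((forall n : nat, (0 < n)%N -> io_decomposable n g (smul sX g))
     <-> paired_seq a)
  /\ (paired_seq a ->
      scong2 (genfun a)
        (sadd (sadd sone sX) (smul (sadd sone sX) (even_part_ge2 a)))).
Proof.
split; last exact: genfun_paired.
apply: iff_trans (io_decomposable_bell hg) _.
exact: odd_fixed_paired.
Qed.
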